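(* In the fixed-design Lasso setting described in the context, suppose the following conditions are satisfied. 1) For some $K>1$, $\kappa:=\kappa(2\|\theta\|_0,K)>0$. 2) For some $C_\gamma>0$, $L(v)-L(\theta)\ge C_\gamma\|X(v-\theta)\|_2^2$ for all $v\in D_0$. 3) Given $q\in(0,1)$, there is $M_q>0$ such that with probability at least $1-q$, $$\Big|\sum_{i=1}^N[\![\gamma_i(X_i^\top\hat\theta,Y_i)-\gamma_i(X_i^\top\theta,Y_i)]\!]\Big|\le M_q\,d\,\|\hat\theta-\theta\|_1 .\qquad( * )$$ Then, by setting $$\lambda=\frac{(K+1)M_q}{K-1}$$ in the Lasso functional $$\hat\theta=\mathop{\arg\min}_{v\in D_0}\Big\{\sum_{i=1}^N\gamma_i(X_i^\top v,Y_i)+\lambda d\|v\|_1\Big\},$$ on the event that $( * )$ holds, $$\|\hat\theta-\theta\|_2\le\frac{M_q\sqrt{\|\theta\|_0}}{N}\times\frac{2\sqrt{2+K^2}\,K\,d}{C_\gamma\kappa^2(K-1)} .$$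
   Context: Setting. $Y_1,\dots,Y_N$ are independent random variables with values in $\mathcal Y$, and the covariates $Z_1,\dots,Z_N\in\mathcal Z$ are fixed. The $\gamma_i:\mathbb R\times\mathcal Y\to\mathbb R$ are given functions, $h=(h_1,\dots,h_p):\mathcal Z\to\mathbb R^p$ is a given function, and $D_0\subset\mathbb R^p$ is a nonempty compact set. $X_i=h(Z_i)$, and $X$ is the $N\times p$ matrix whose $i$-th row is $X_i^\top$. The following standing assumptions hold. (Regularity) There are $m\in\{0,1,2,\dots\}$, $-\infty\le a_i<b_i\le\infty$ and constants $F_m,F_{m+1}$ such that with probability 1, for each $i\le N$, $t\mapsto\gamma_i(t,Y_i)$ is $m$ times differentiable on $(a_i,b_i)$ with $|\partial^m\gamma_i(t,Y_i)/\partial t^m|\le F_m$ and $|\partial^m\gamma_i(t,Y_i)/\partial t^m-\partial^m\gamma_i(t',Y_i)/\partial t^m|\le F_{m+1}|t-t'|$ for all $t,t'\in(a_i,b_i)$. (Boundedness) There is a constant $d\in(0,\infty)$ with $|h_j(Z_i)|\le d$ for all $i\le N$, $j\le p$. (Parameter Domain) $h(Z_i)^\top v\in(a_i,b_i)$ for all $v\in D_0$, $i\le N$. $L(v)=\sum_{i=1}^N\mathsf E[\gamma_i(X_i^\top v,Y_i)]$ for $v\in D_0$ (expectations finite), and $\theta\in D_0$ is a minimizer of $L$ over $D_0$. $\hat\theta$ is a minimizer in the Lasso functional, with tuning parameter $\lambda>0$. Notation. For $v\in\mathbb R^p$, $\|v\|_0$ is the number of nonzero coordinates of $v$; for $J\subset\{1,\dots,p\}$,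 $v_J$ is the vector with $i$-th coordinate $v_i$ for $i\in J$ and $0$ otherwise, and $J^c$ is the complement. $\|\cdot\|_1,\|\cdot\|_2$ are the $\ell_1,\ell_2$ norms. The centering is $[\![\gamma_i(X_i^\top v,Y_i)]\!]=\gamma_i(X_i^\top v,Y_i)-\mathsf E[\gamma_i(X_i^\top v,Y_i)]$ for each fixed $v\in D_0$; in $( * )$ the centered functions are formed for fixed $v$ and then evaluated at $v=\hat\theta$, i.e. the sum equals $\sum_i[\gamma_i(X_i^\top\hat\theta,Y_i)-\gamma_i(X_i^\top\theta,Y_i)]-(L(\hat\theta)-L(\theta))$. For $1\le s\le p$ and $K>0$, $$\kappa(s,K)=\min\Big\{\frac{\|Xv\|_2}{\sqrt N\,\|v_J\|_2}:\ 1\le|J|\le s,\ v\ne0,\ \|v_{J^c}\|_1\le K\|v_J\|_1\Big\},$$ the minimum being over $J\subset\{1,\dots,p\}$ and $v\in\mathbb R^p$; condition 1) presupposes $1\le2\|\theta\|_0\le p$. *)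

(* Defs.v *)
From HB Require Import structures.
From mathcomp Require Import all_boot all_order all_algebra.
From mathcomp Require Import all_classical all_reals all_analysis.

Set Implicit Arguments.
Unset Strict Implicit.
Unset Printing Implicit Defensive.

Import Order.TTheory GRing.Theory Num.Theory.
Import numFieldNormedType.Exports.

Local Open Scope classical_set_scope.
Local Open Scope ring_scope.

Section Vectors.
Context {R : realType}.

Definition l0norm p (v : 'cV[R]_p) : nat := #|[set j : 'I_p | v j 0 != 0]%SET|.

Definition l1norm p (v : 'cV[R]_p) : R := \sum_j `|v j 0|.

Definition l2norm p (v : 'cV[R]_p) : R := Num.sqrt (\sum_j v j 0 ^+ 2).

Definition restr p (J : {set 'I_p}) (v : 'cV[R]_p) : 'cV[R]_p :=
  \col_j (if j \in J then v j 0 else 0).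

Definition kappa_ratios N p (X : 'M[R]_(N, p)) (s : nat) (K : R) : set R :=
  [set r | exists (J : {set 'I_p}) (v : 'cV[R]_p),
    [/\ (1 <= #|J| <= s)%N,
        v != 0,
        l1norm (restr (~: J)%SET v) <= K * l1norm (restr J v) &
        r = l2norm (X *m v) / (Num.sqrt N%:R * l2norm (restr J v))]].

(* For 0 < N, 1 <= s and 1 <= p the infimum is attained: the ratio does not
   change when v is rescaled, there are finitely many J, and for each of them
   the constraints and the equation l2norm v = 1 define a compact set of v, on
   which the denominator does not vanish. So this infimum is the minimum. *)
Definition kappa N p (X : 'M[R]_(N, p)) (s : nat) (K : R) : R :=
  inf (kappa_ratios X s K).

(* (design h Z *m v) i 0 is the linear predictor h(Z_i)^T v = X_i^T v. *)
Definition design N p (ZZ : Type) (h : 'I_p -> ZZ -> R) (Z : 'I_N -> ZZ) :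
  'M[R]_(N, p) := \matrix_(i, j) h j (Z i).

Definition times_differentiable (m : nat) (A : set R) (f : R -> R) : Prop :=
  forall (k : nat) (t : R), (k < m)%N -> A t -> derivable (derive1n k f) t 1.

End Vectors.

Section Probability.
Context {disp : measure_display} {T : measurableType disp} {R : realType}.
Variable P : probability T R.

Definition mutually_independent (dispY : measure_display)
    (YY : measurableType dispY) (N : nat) (Y : 'I_N -> {RV P >-> YY}) : Prop :=
  forall (J : {set 'I_N}) (B : 'I_N -> set YY),
    (forall i, i \in J -> measurable (B i)) ->
    P [set w | forall i, i \in J -> B i (Y i w)] =
    (\prod_(i in J) P (Y i @^-1` B i))%E.

(* fine is harmless where f is integrable, its expectation being finite. *)
Definition expectR (f : T -> R) : R := fine ('E_P[f])%E.

Definition centered (f : T -> R) (w : T) : R := f w - expectR f.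

(* Inner probability: the set E need not be measurable. For a measurable E this
   says exactly that r <= P E. *)
Definition with_probability_at_least (r : R) (E : set T) : Prop :=
  exists A : set T, [/\ measurable A, A `<=` E & (r%:E <= P A)%E].

End Probability.

Section Lasso.
Context {disp dispY : measure_display} {T : measurableType disp} {R : realType}.
Variable P : probability T R.
Context {YY : measurableType dispY} {N p : nat}.
Variables (gamma : 'I_N -> R -> YY -> R) (Y : 'I_N -> {RV P >-> YY}).
Variable X : 'M[R]_(N, p).

Definition loss_term (i : 'I_N) (v : 'cV[R]_p) (w : T) : R :=
  gamma i ((X *m v) i 0) (Y i w).

Definition risk (v : 'cV[R]_p) : R :=
  \sum_(i < N) expectR P (loss_term i v).

Definition lasso_objective (lambda d : R) (w : T) (v : 'cV[R]_p) : R :=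
  \sum_(i < N) loss_term i v w + lambda * d * l1norm v.

(* The centering is done at the fixed vector v, so evaluating at a random vector
   amounts to substituting v := thetahat w in excess_sum theta v w. *)
Definition excess_sum (theta v : 'cV[R]_p) (w : T) : R :=
  \sum_(i < N) centered P (fun w' => loss_term i v w' - loss_term i theta w') w.

End Lasso.

Definition minimizer_on (V : Type) (R : realType) (D : set V) (F : V -> R)
    (x : V) : Prop :=
  D x /\ forall y, D y -> F x <= F y.

(* Main.v *)
Require Import Defs.
From HB Require Import structures.
From mathcomp Require Import all_boot all_order all_algebra.
From mathcomp Require Import all_classical all_reals all_analysis.
From mathcomp Require Import ring lra.

Import Order.TTheory GRing.Theory Num.Theory.
Import numFieldNormedType.Exports.

(** Write delta = thetahat - theta, S for the support of theta, s for its size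
    and C for Cgamma. Optimality of thetahat, compared with theta, bounds the
    risk gap by the centered sum plus the penalty difference; the gap dominates
    C * |X delta|_2^2, the centered sum is at most Mq * d * |delta|_1, and theta
    vanishes off S, so that (lemma [basic_inequality])

      C * |X delta|_2^2
        <= (2 Mq d / (K - 1)) * (K |delta_S|_1 - |delta_(S^c)|_1).

    The choice of lambda is exactly what makes the two weights on the right have
    ratio K. Since the left side is nonnegative, delta lies in the cone
    |delta_(S^c)|_1 <= K |delta_S|_1, and |X delta|_2^2 is controlled by
    |delta_S|_1, hence by sqrt s times an l2 norm.

    It remains to bound the whole of |delta|_2 although kappa only controls
    |delta_J|_2 for small J. Let J be S together with the s largest entries of
    delta off S; this is where the factor 2 in kappa (2 s) comes from. The
    entries outside J are each at most |delta_(S^c)|_1 / s, so that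

      |delta_(J^c)|_2^2 <= |delta_(S^c)|_1^2 / s <= K^2 |delta_S|_1^2 / s
                        <= K^2 |delta_S|_2^2 <= K^2 |delta_J|_2^2

    (lemma [cone_l2norm_le]). The cone condition for S implies the one for J, so
    kappa sqrt N |delta_J|_2 <= |X delta|_2, and dividing the resulting quadratic
    inequality by |delta_J|_2 bounds it (lemma [restricted_eigenvalue_bound]).
    The argument is pointwise in the sample: by linearity of the expectation
    ([excess_sumE]) the centered sum at a sample point is the empirical loss gap
    minus the risk gap. The constant obtained is sqrt (1 + K^2), which is at most
    sqrt (2 + K^2). *)

Set Implicit Arguments.
Unset Strict Implicit.

Local Open Scope classical_set_scope.
Local Open Scope ring_scope.

(** * Finite sums and largest entries *)

(** The Cauchy-Schwarz inequality against the constant 1, obtained by summing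
    2 * f i * f j <= f i ^+ 2 + f j ^+ 2 over all pairs. *)
Lemma sqr_sum_le_card (R : realFieldType) (I : finType) (A : {set I})
    (f : I -> R) :
  (\sum_(i in A) f i) ^+ 2 <= #|A|%:R * \sum_(i in A) f i ^+ 2.
Proof.
suff H : 2 * (\sum_(i in A) f i) ^+ 2
         <= 2 * (#|A|%:R * \sum_(i in A) f i ^+ 2).
  by rewrite -(ler_pM2l (x := 2)).
have -> : 2 * (#|A|%:R * \sum_(i in A) f i ^+ 2)
          = \sum_(i in A) \sum_(j in A) (f i ^+ 2 + f j ^+ 2).
  under [RHS]eq_bigr do rewrite big_split /= sumr_const.
  by rewrite big_split /= sumr_const sumrMnl -mulr_natl; ring.
rewrite expr2 mulr_suml mulr_sumr; apply: ler_sum => i _.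
rewrite !mulr_sumr; apply: ler_sum => j _.
rewrite -subr_ge0 (_ : _ - _ = (f i - f j) ^+ 2) ?sqr_ge0 //; ring.
Qed.

Lemma exists_largest_entries (disp : Order.disp_t) (R : orderType disp)
    (I : finType) (f : I -> R) (A : {set I}) (s : nat) : (s <= #|A|)%N ->
  exists B : {set I}, [/\ B \subset A, #|B| = s &
    forall i j, i \in B -> j \in A :\: B -> (f j <= f i)%O].
Proof.
elim: s => [_|s IHs sA].
  by exists finset.set0; split=> [||i j]; rewrite ?finset.sub0set ?cards0 ?inE.
have [B [BA Bs Btop]] := IHs (ltnW sA).
have /card_gt0P[i0 i0AB] : (0 < #|A :\: B|)%N.
  by rewrite cardsD (finset.setIidPr BA) subn_gt0 Bs.
case: (arg_maxP f i0AB) => i /= iAB imax.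
exists (i |: B); split=> [||k j].
- rewrite finset.subUset BA andbT finset.sub1set.
  by have /setDP[] := iAB.
- by have /setDP[_ iB] := iAB; rewrite cardsU1 Bs iB.
- rewrite !inE negb_or => /orP[/eqP ->|kB] /andP[/andP[ji jB] jA].
    by apply: imax; apply/setDP.
  by apply: Btop; rewrite // !inE jB.
Qed.

(** Each entry outside B is at most every entry in B, hence at most their
    average, and so at most the total over A divided by the size of B. *)
Lemma sum_sqr_tail_le (R : realFieldType) (I : finType) (f : I -> R)
    (A B : {set I}) :
  (forall i, 0 <= f i) -> B \subset A ->
  (forall i j, i \in B -> j \in A :\: B -> f j <= f i) ->
  #|B|%:R * \sum_(j in A :\: B) f j ^+ 2 <= (\sum_(i in A) f i) ^+ 2.
Proof.
move=> f0 BA Btop.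
have splitA : \sum_(i in A) f i
    = \sum_(i in B) f i + \sum_(j in A :\: B) f j.
  by rewrite (big_setID B) /= (finset.setIidPr BA).
have B0 : 0 <= \sum_(i in B) f i by apply: sumr_ge0.
have D0 : 0 <= \sum_(j in A :\: B) f j by apply: sumr_ge0.
apply: (@le_trans _ _ ((\sum_(i in A) f i) * \sum_(j in A :\: B) f j)).
  rewrite !mulr_sumr; apply: ler_sum => j jAB.
  rewrite expr2 mulrA ler_wpM2r //.
  apply: (@le_trans _ _ (\sum_(i in B) f i)); last by rewrite splitA lerDl.
  by rewrite mulr_natl -sumr_const; apply: ler_sum => i iB; apply: Btop.
by rewrite expr2 ler_wpM2l ?splitA ?addr_ge0 // lerDr.
Qed.

(** * Norms of restrictions and cones *)

Section Restrictions.
Context {R : realType} {p : nat}.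
Implicit Types (J S : {set 'I_p}) (v theta delta : 'cV[R]_p).

Lemma l1norm_restr J v : l1norm (restr J v) = \sum_(j in J) `|v j 0|.
Proof.
rewrite /l1norm [RHS]big_mkcond; apply: eq_bigr => j _.
by rewrite mxE; case: ifP; rewrite ?normr0.
Qed.

Lemma l2norm_restr J v :
  l2norm (restr J v) = Num.sqrt (\sum_(j in J) v j 0 ^+ 2).
Proof.
rewrite /l2norm [in RHS]big_mkcond; congr Num.sqrt; apply: eq_bigr => j _.
by rewrite mxE; case: ifP; rewrite ?expr0n.
Qed.

Lemma l2norm_ge0 n (v : 'cV[R]_n) : 0 <= l2norm v.
Proof. exact: sqrtr_ge0. Qed.

Lemma l2norm0 n : l2norm (0 : 'cV[R]_n) = 0.
Proof. by rewrite /l2norm big1 ?sqrtr0 // => j _; rewrite mxE expr0n. Qed.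

Lemma sum_entries_split J v (F : R -> R) :
  \sum_j F (v j 0) = \sum_(j in J) F (v j 0) + \sum_(j in ~: J) F (v j 0).
Proof.
by rewrite (bigID (mem J)) /=; congr (_ + _); apply: eq_bigl => j; rewrite !inE.
Qed.

Lemma l1norm_split J v :
  l1norm v = l1norm (restr J v) + l1norm (restr (~: J)%SET v).
Proof. by rewrite !l1norm_restr -sum_entries_split. Qed.

Lemma l1norm_restr_le_l2 J v :
  l1norm (restr J v) <= Num.sqrt #|J|%:R * l2norm (restr J v).
Proof.
rewrite l1norm_restr l2norm_restr -sqrtrM //.
rewrite -[leLHS]ger0_norm ?sumr_ge0 // -sqrtr_sqr ler_wsqrtr //.
apply: (le_trans (sqr_sum_le_card J (fun j => `|v j 0|))).
by under eq_bigr do rewrite real_normK ?num_real //.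
Qed.

(** On S the triangle inequality applies; off S, theta vanishes, so v and
    v - theta coincide there. *)
Lemma l1norm_sub_support_le S theta v :
  (forall j, j \notin S -> theta j 0 = 0) ->
  l1norm theta - l1norm v
    <= l1norm (restr S (v - theta)) - l1norm (restr (~: S)%SET (v - theta)).
Proof.
move=> thetaS; rewrite (l1norm_split S theta) (l1norm_split S v) !l1norm_restr.
have -> : \sum_(j in ~: S) `|theta j 0| = 0.
  by rewrite big1 // => j; rewrite finset.in_setC => /thetaS ->; rewrite normr0.
have -> : \sum_(j in ~: S) `|(v - theta) j 0| = \sum_(j in ~: S) `|v j 0|.
  apply: eq_bigr => j; rewrite finset.in_setC => /thetaS thj.
  by rewrite !mxE thj oppr0 addr0.
rewrite addr0 opprD addrA lerD2r lerBlDl -big_split /=.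
apply: ler_sum => j _; rewrite !mxE distrC.
by rewrite -[X in `|X|](subrK (v j 0)) addrC ler_normD.
Qed.

(** Inside the l1 cone around S, adding to S the #|S| largest remaining entries
    captures a fixed proportion of the l2 norm: by [sum_sqr_tail_le] the squares
    left out sum to at most the squared l1 norm off S divided by #|S|, which the
    cone condition and Cauchy-Schwarz turn into K ^+ 2 times the squares on S. *)
Lemma cone_l2norm_le S delta (K : R) :
  (0 < #|S|)%N -> (2 * #|S| <= p)%N -> 0 <= K ->
  l1norm (restr (~: S)%SET delta) <= K * l1norm (restr S delta) ->
  exists J : {set 'I_p}, [/\ S \subset J, #|J| = (2 * #|S|)%N &
    l2norm delta <= Num.sqrt (1 + K ^+ 2) * l2norm (restr J delta)].
Proof.
move=> S0 Sp K0 cone.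
(* The hypothesis on p leaves room for #|S| entries off S. *)
have sSC : (#|S| <= #|~: S|)%N.
  by rewrite -(leq_add2l #|S|) cardsC card_ord addnn -mul2n.
have [B [BS Bs Btop]] :=
  exists_largest_entries (fun j => `|delta j 0|) sSC.
have SB0 : (S :&: B = finset.set0)%SET.
  by apply/eqP; rewrite finset.setI_eq0 disjoint_sym finset.disjoints_subset.
exists (S :|: B); split; first exact: finset.subsetUl.
  by rewrite cardsU SB0 cards0 subn0 Bs mul2n addnn.
rewrite [l2norm delta]/l2norm l2norm_restr -sqrtrM ?addr_ge0 ?sqr_ge0 //.
rewrite ler_wsqrtr // (sum_entries_split (S :|: B) delta (fun x => x ^+ 2)).
rewrite mulrDl mul1r lerD2l.
have tail := sum_sqr_tail_le (fun j => normr_ge0 (delta j 0)) BS Btop.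
rewrite Bs -l1norm_restr in tail.
have -> : \sum_(j in ~: (S :|: B)) delta j 0 ^+ 2
    = \sum_(j in ~: S :\: B) `|delta j 0| ^+ 2.
  rewrite finset.setCU finset.setDE.
  by apply: eq_bigr => j _; rewrite real_normK ?num_real.
have S0R : 0 < #|S|%:R :> R by rewrite ltr0n.
rewrite -(ler_pM2l S0R); apply: le_trans tail _.
have /(lerXn2r 2) := cone; rewrite !nnegrE => /(_ _ _)/le_trans; apply.
- by rewrite l1norm_restr sumr_ge0.
- by rewrite mulr_ge0 // l1norm_restr sumr_ge0.
rewrite exprMn [leRHS]mulrCA ler_wpM2l ?sqr_ge0 //.
apply: (@le_trans _ _ (#|S|%:R * \sum_(j in S) delta j 0 ^+ 2)).
  rewrite l1norm_restr; apply: (le_trans (sqr_sum_le_card _ _)).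
  by under eq_bigr do rewrite real_normK ?num_real //.
rewrite ler_wpM2l // [leRHS](big_setID S) /=.
rewrite (finset.setIidPr (finset.subsetUl S B)) lerDl.
by apply: sumr_ge0 => j _; apply: sqr_ge0.
Qed.

(** Enlarging S moves l1 mass from the left side to the right side. *)
Lemma cone_monotone S J v (K : R) :
  S \subset J -> 0 <= K ->
  l1norm (restr (~: S)%SET v) <= K * l1norm (restr S v) ->
  l1norm (restr (~: J)%SET v) <= K * l1norm (restr J v).
Proof.
move=> SJ K0 cone.
have SJ1 : l1norm (restr S v) <= l1norm (restr J v).
  rewrite !l1norm_restr [leRHS](big_setID S) /= (finset.setIidPr SJ) lerDl.
  exact: sumr_ge0.
have := ler_wpM2l K0 SJ1.
have := l1norm_split S v; have := l1norm_split J v; lra.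
Qed.

End Restrictions.

(** * Restricted eigenvalue *)

Lemma kappa_le_ratio (R : realType) N p (X : 'M[R]_(N, p)) (s : nat) (K : R)
    (J : {set 'I_p}) (v : 'cV[R]_p) :
  (1 <= #|J| <= s)%N -> v != 0 ->
  l1norm (restr (~: J)%SET v) <= K * l1norm (restr J v) ->
  kappa X s K <= l2norm (X *m v) / (Num.sqrt N%:R * l2norm (restr J v)).
Proof.
move=> Js v0 cone; apply: ge_inf; last by exists J, v.
exists 0 => _ [J' [v' [_ _ _ ->]]].
by rewrite divr_ge0 ?mulr_ge0 ?sqrtr_ge0.
Qed.

(** The quadratic inequality C * |X delta|^2 <= B * |delta_S|_1 is bounded below
    by a multiple of |delta_J|_2^2 and above by one of |delta_J|_2; cancelling
    one factor bounds |delta_J|_2, and [cone_l2norm_le] passes to delta. *)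
Lemma restricted_eigenvalue_bound (R : realType) N p (X : 'M[R]_(N, p))
    (K C B : R) (S : {set 'I_p}) (delta : 'cV[R]_p) :
  (0 < #|S|)%N -> (2 * #|S| <= p)%N -> 0 <= K -> 0 < C -> 0 <= B ->
  0 < kappa X (2 * #|S|) K ->
  l1norm (restr (~: S)%SET delta) <= K * l1norm (restr S delta) ->
  C * l2norm (X *m delta) ^+ 2 <= B * l1norm (restr S delta) ->
  l2norm delta <= Num.sqrt (1 + K ^+ 2) *
    (B * Num.sqrt #|S|%:R / (C * kappa X (2 * #|S|) K ^+ 2 * N%:R)).
Proof.
move=> S0 Sp K0 C0 B0 kap0 cone bound.
set kap := kappa _ _ _ in kap0 *.
have [->|delta0] := eqVneq delta 0.
  rewrite l2norm0 mulr_ge0 ?divr_ge0 ?mulr_ge0 ?sqrtr_ge0 ?sqr_ge0 // ltW //.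
have [J [SJ Jcard tail]] := cone_l2norm_le S0 Sp K0 cone.
have coneJ := cone_monotone SJ K0 cone.
have Js : (1 <= #|J| <= 2 * #|S|)%N by rewrite Jcard leqnn muln_gt0 S0.
have ratio : kap <= _ := kappa_le_ratio X Js delta0 coneJ.
set x := l2norm (restr J delta) in tail ratio.
have sqrtN0 := sqrtr_ge0 (N%:R : R).
have x0 : 0 <= x by exact: l2norm_ge0.
(* Division by zero is zero, so the positive ratio forces both factors of its
   denominator to be nonzero. *)
have /andP[N0 x1] : (0 < Num.sqrt (N%:R : R)) && (0 < x).
  rewrite !lt0r sqrtN0 x0 !andbT -negb_or -mulf_eq0.
  by apply: contraTneq (lt_le_trans kap0 ratio) => ->; rewrite invr0 mulr0 ltxx.
have NE : Num.sqrt N%:R ^+ 2 = N%:R :> R by rewrite sqr_sqrtr.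
have NR0 : 0 < N%:R :> R by rewrite -NE exprn_gt0.
rewrite ler_pdivlMr ?mulr_gt0 // in ratio.
apply: le_trans tail _; rewrite ler_wpM2l ?sqrtr_ge0 //.
rewrite ler_pdivlMr ?mulr_gt0 ?exprn_gt0 // -(ler_pM2r x1).
(* The rate sqrt #|S| is the price of passing from l1 to l2 on S. *)
have aS : l1norm (restr S delta) <= Num.sqrt #|S|%:R * x.
  apply: (le_trans (l1norm_restr_le_l2 S delta)).
  rewrite ler_wpM2l ?sqrtr_ge0 // /x !l2norm_restr ler_wsqrtr //.
  rewrite [leRHS](big_setID S) /= (finset.setIidPr SJ) lerDl.
  by apply: sumr_ge0 => j _; apply: sqr_ge0.
rewrite -(mulrA B); apply: le_trans (ler_wpM2l B0 aS).
apply: le_trans bound.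
rewrite -NE (_ : _ * x = C * (kap * (Num.sqrt N%:R * x)) ^+ 2); last by ring.
rewrite ler_wpM2l ?(ltW C0) // lerXn2r ?nnegrE ?l2norm_ge0 //.
by rewrite ltW // !mulr_gt0.
Qed.

(** * Basic inequality *)

(** Integrability is what lets the centering constants of the differences be
    collected into a difference of risks: [fine] is additive only on finite
    values. *)
Lemma excess_sumE (disp dispY : measure_display) (T : measurableType disp)
    (R : realType) (P : probability T R) (YY : measurableType dispY) (N p : nat)
    (gamma : 'I_N -> R -> YY -> R) (Y : 'I_N -> {RV P >-> YY})
    (X : 'M[R]_(N, p)) (theta v : 'cV[R]_p) (w : T) :
  (forall i, P.-integrable setT (EFin \o loss_term gamma Y X i theta)) ->
  (forall i, P.-integrable setT (EFin \o loss_term gamma Y X i v)) ->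
  excess_sum gamma Y X theta v w =
    (\sum_(i < N) loss_term gamma Y X i v w
      - \sum_(i < N) loss_term gamma Y X i theta w)
    - (risk gamma Y X v - risk gamma Y X theta).
Proof.
move=> Itheta Iv; rewrite /excess_sum /risk -!sumrB; apply: eq_bigr => i _.
rewrite /centered /expectR; congr (_ - _).
have /Lfun1_integrable Lv := Iv i; have /Lfun1_integrable Lt := Itheta i.
by rewrite expectationB // fineB ?expectation_fin_num.
Qed.

(** With lambda = (K + 1) M / (K - 1), the noise term and the penalty add up to
    (2 M d / (K - 1)) * (K a - b): the weight lambda + M of a (the l1 norm on the
    support) is K times the weight lambda - M of b (the l1 norm off it). *)
Lemma basic_inequality (R : realFieldType) (K M d g a b : R) :
  1 < K -> 0 < M -> 0 < d -> 0 <= b -> 0 <= g ->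
  g <= M * d * (a + b) + (K + 1) * M / (K - 1) * d * (a - b) ->
  b <= K * a /\ g <= 2 * K * M * d / (K - 1) * a.
Proof.
move=> K1 M0 d0 b0 g0.
have K1' : 0 < K - 1 by rewrite subr_gt0.
have K0 : 0 < K by lra.
have -> : M * d * (a + b) + (K + 1) * M / (K - 1) * d * (a - b)
          = 2 * M * d / (K - 1) * (K * a - b).
  by field; rewrite gt_eqF.
have c0 : 0 < 2 * M * d / (K - 1) by rewrite divr_gt0 ?mulr_gt0.
move=> gle; split.
  by rewrite -subr_ge0 -(pmulr_rge0 _ c0) (le_trans g0).
apply: (le_trans gle).
have -> : 2 * K * M * d / (K - 1) * a = 2 * M * d / (K - 1) * (K * a) by ring.
by rewrite ler_wpM2l ?(ltW c0) // gerBl.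
Qed.

Unset Implicit Arguments.
Set Strict Implicit.

(** * The estimation bound *)

Theorem theorem3p1
  (disp dispY : measure_display) (T : measurableType disp) (R : realType)
  (P : probability T R) (YY : measurableType dispY) (ZZ : Type) (N p : nat)
  (Y : 'I_N -> {RV P >-> YY}) (Z : 'I_N -> ZZ)
  (gamma : 'I_N -> R -> YY -> R) (h : 'I_p -> ZZ -> R) (D0 : set 'cV[R]_p)
  (m : nat) (a b : 'I_N -> \bar R) (Fm Fm1 d : R)
  (theta : 'cV[R]_p) (thetahat : T -> 'cV[R]_p)
  (K Cgamma q Mq : R) :
  let X := design h Z in
  let I i := [set t : R | (a i < t%:E < b i)%E] in
  let lambda := (K + 1) * Mq / (K - 1) in
  let lasso_minimizer w :=
    minimizer_on D0 (lasso_objective gamma Y X lambda d w) (thetahat w) in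
  let star w :=
    `|excess_sum gamma Y X theta (thetahat w) w|
      <= Mq * d * l1norm (thetahat w - theta) in
  mutually_independent Y ->
  D0 !=set0 -> compact D0 ->
  (forall i, (a i < b i)%E) ->
  {ae P, forall w, forall i : 'I_N,
    let g := derive1n m (fun t => gamma i t (Y i w)) in
    [/\ times_differentiable m (I i) (fun t => gamma i t (Y i w)),
        forall t, I i t -> `|g t| <= Fm &
        forall t t', I i t -> I i t' -> `|g t - g t'| <= Fm1 * `|t - t'|]} ->
  0 < d ->
  (forall i j, `|h j (Z i)| <= d) ->
  (forall v i, D0 v -> I i ((X *m v) i 0)) ->
  (forall v i, D0 v ->
    P.-integrable setT (EFin \o loss_term gamma Y X i v)) ->
  minimizer_on D0 (risk gamma Y X) theta ->
  (1 <= 2 * l0norm theta <= p)%N ->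
  1 < K -> 0 < kappa X (2 * l0norm theta) K ->
  0 < Cgamma ->
  (forall v, D0 v ->
    risk gamma Y X v - risk gamma Y X theta
      >= Cgamma * l2norm (X *m (v - theta)) ^+ 2) ->
  0 < q < 1 -> 0 < Mq ->
  {ae P, forall w, lasso_minimizer w} ->
  with_probability_at_least P (1 - q) [set w | star w] ->
  forall w, lasso_minimizer w -> star w ->
    l2norm (thetahat w - theta)
      <= Mq * Num.sqrt (l0norm theta)%:R / N%:R
         * (2 * Num.sqrt (2 + K ^+ 2) * K * d
            / (Cgamma * kappa X (2 * l0norm theta) K ^+ 2 * (K - 1))).
Proof.
move=> X I lambda lasso_minimizer star _ _ _ _ _ d0 _ _ Iloss [theta_D _].
move=> /andP[supp0 suppp] K1 kap0 C0 margin _ M0 _ _ w [vD vmin] starw.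
set v := thetahat w in vD vmin starw *.
set S := [set j : 'I_p | theta j 0 != 0]%SET.
have SE : #|S| = l0norm theta by [].
have thetaS j : j \notin S -> theta j 0 = 0.
  by rewrite inE negbK => /eqP.
have := vmin _ theta_D; rewrite /lasso_objective => objective_le.
have := starw; rewrite /star excess_sumE //; last 2 first.
- by move=> i; apply: Iloss.
- by move=> i; apply: Iloss.
rewrite ler_norml => /andP[noise _].
have l1diff := l1norm_sub_support_le v thetaS.
have delta_split := l1norm_split S (v - theta).
have K0 : 0 < K by lra.
have K1' : 0 < K - 1 by rewrite subr_gt0.
have ld0 : 0 <= lambda * d.
  have K1'' : 0 < K + 1 by lra.
  by rewrite ltW // /lambda mulr_gt0 ?divr_gt0 ?mulr_gt0.
have penalty := ler_wpM2l ld0 l1diff.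
have marginv := margin v vD.
have b0 : 0 <= l1norm (restr (~: S)%SET (v - theta)).
  by rewrite l1norm_restr sumr_ge0.
set b' := l1norm (restr (~: S)%SET (v - theta)) in penalty delta_split b0.
set a' := l1norm (restr S (v - theta)) in penalty delta_split.
have [] := @basic_inequality _ K Mq d
  (Cgamma * l2norm (X *m (v - theta)) ^+ 2) a' b' K1 M0 d0 b0.
- by rewrite mulr_ge0 ?sqr_ge0 // ltW.
- (* Margin condition at v, noise bound, optimality of v, and the l1 comparison
     scaled by lambda * d. *)
  rewrite -delta_split -/lambda; rewrite -/v in noise; lra.
move=> cone bound.
set B := 2 * K * Mq * d / (K - 1) in bound.
have B0 : 0 <= B by rewrite ltW ?divr_gt0 ?mulr_gt0.
have S0 : (0 < #|S|)%N by move: supp0; rewrite muln_gt0.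
have := @restricted_eigenvalue_bound _ _ _ X K Cgamma B S (v - theta)
  S0 suppp (ltW K0) C0 B0 kap0 cone.
rewrite SE => est.
apply: le_trans (est bound) _.
set kap := kappa _ _ _.
apply: (@le_trans _ _ (Num.sqrt (2 + K ^+ 2) *
  (B * Num.sqrt (l0norm theta)%:R / (Cgamma * kap ^+ 2 * N%:R)))).
  rewrite ler_wpM2r ?ler_wsqrtr ?lerD2r ?ler1n //.
  by rewrite divr_ge0 // mulr_ge0 ?sqrtr_ge0 // mulr_ge0 ?sqr_ge0 // ltW.
rewrite le_eqVlt; apply/predU1P; left; rewrite /B !invfM; ring.
Qed.
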